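(* Let $G$ be a connected simple graph on $n$ vertices and let $F=\{f_i\}_{i\in[n]}$ be a frame generated by $G$. Then $F$ is a tight frame if and only if $G$ is a complete graph.
   Context: $[n]=\{1,\dots,n\}$. A sequence $\{f_i\}_{i\in[n]}$ in $\mathbb{C}^k$ is a frame for $\mathbb{C}^k$ if there are constants $A,B>0$ with $A\|f\|^2\le\sum_{i\in[n]}|\langle f,f_i\rangle|^2\le B\|f\|^2$ for all $f\in\mathbb{C}^k$; it is a tight frame if one can take $A=B$. Its Gramian matrix is the $n\times n$ matrix whose $(i,j)$ entry is $\langle f_j,f_i\rangle$ (inner product linear in the first argument). The Laplacian matrix of a simple graph $G$ with vertices $v_1,\dots,v_n$ is $L(G)=D(G)-A(G)$, where $D(G)$ is the diagonal matrix of vertex degrees and $A(G)$ is the adjacency matrix. A frame $\{f_i\}_{i\in[n]}$ for $\mathbb{C}^k$ is said to be generated by $G$ (a $G(n,k)$-frame) if its Gramian matrix equals $L(G)$; for connected $G$, necessarily $k=n-1$. A graph is complete if every two distinct vertices are adjacent. *)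

(* Defs.v *)
From HB Require Import structures.
From mathcomp Require Import all_boot all_order all_algebra.
From mathcomp Require Import reals complex.

Set Implicit Arguments.
Unset Strict Implicit.
Unset Printing Implicit Defensive.

Import Order.TTheory GRing.Theory Num.Theory.

Local Open Scope ring_scope.
Local Open Scope complex_scope.

Record simple_graph (n : nat) := SimpleGraph {
  adj :> rel 'I_n;
  adj_sym : symmetric adj;
  adj_irrefl : irreflexive adj
}.

Definition connected_graph (n : nat) (G : simple_graph n) : Prop :=
  forall i j : 'I_n, connect G i j.

Definition complete_graph (n : nat) (G : simple_graph n) : Prop :=
  forall i j : 'I_n, i != j -> adj G i j.

Definition degree (n : nat) (G : simple_graph n) (i : 'I_n) : nat :=
  #|[set j | adj G i j]|.

Definition degree_matrix (K : pzRingType) (n : nat) (G : simple_graph n) :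
    'M[K]_n :=
  diag_mx (\row_i (degree G i)%:R).

Definition adjacency_matrix (K : pzRingType) (n : nat) (G : simple_graph n) :
    'M[K]_n :=
  \matrix_(i, j) (adj G i j)%:R.

Definition laplacian (K : pzRingType) (n : nat) (G : simple_graph n) :
    'M[K]_n :=
  degree_matrix K G - adjacency_matrix K G.

(* [dotmx u v] is the sum of the [u 0 l * (v 0 l)^*]: it is linear in its first
   argument, and [dotmx u u] is the square of the Euclidean norm of [u].  The
   order on [R[i]] is partial: [x <= y] says that [y - x] is a nonnegative
   real, so below it compares real numbers embedded in [R[i]]. *)
Definition frame_bounds (R : realType) (n k : nat) (A B : R)
    (F : 'I_n -> 'rV[R[i]]_k) : Prop :=
  forall f : 'rV[R[i]]_k,
    A%:C * dotmx f f <= \sum_(i < n) `|dotmx f (F i)| ^+ 2 <= B%:C * dotmx f f.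

Definition is_frame (R : realType) (n k : nat) (F : 'I_n -> 'rV[R[i]]_k) :
    Prop :=
  exists A B : R, [/\ 0 < A, 0 < B & frame_bounds A B F].

Definition is_tight_frame (R : realType) (n k : nat)
    (F : 'I_n -> 'rV[R[i]]_k) : Prop :=
  exists A : R, 0 < A /\ frame_bounds A A F.

Definition gramian (R : realType) (n k : nat) (F : 'I_n -> 'rV[R[i]]_k) :
    'M[R[i]]_n :=
  \matrix_(i, j) dotmx (F j) (F i).

Definition frame_generated_by (R : realType) (n k : nat) (G : simple_graph n)
    (F : 'I_n -> 'rV[R[i]]_k) : Prop :=
  is_frame F /\ gramian F = laplacian R[i] G.

(* Main.v *)
Require Import Defs.
From mathcomp Require Import all_boot all_order all_algebra.
From mathcomp Require Import reals complex.

(** Write [M] for the matrix whose rows are the frame vectors.  The sum of the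
    [|<f, f_i>|^2] is the quadratic form of the frame operator [S = M^* M],
    while the Gramian is, up to transposition, [Q = M M^*].  By polarization
    the frame is tight with bound [a] exactly when [S = a I], and because the
    vectors span, this amounts to [Q^2 = a Q]
    ([tight_bound_gramian]).  Tightness thus becomes a statement about the
    Laplacian [L]: it satisfies [L^2 = a L] for some [a > 0].

    If [G] is complete then [L = n I - J], where [J] is the all-ones matrix,
    and [L J = 0] gives [L^2 = n L].  Conversely, suppose [L^2 = a L] and let
    [i], [j] be distinct and nonadjacent.  Then the [(i, j)] entry of [L^2],
    which counts the common neighbours of [i] and [j], is [a L_ij = 0].
    So two distinct vertices with a common neighbour are adjacent
    ([laplacian_sq_adj_trans]), and in a connected graph this propagates
    along paths to all pairs of vertices. *)

Set Implicit Arguments.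
Unset Strict Implicit.
Unset Printing Implicit Defensive.

Import Order.TTheory GRing.Theory Num.Theory.

Local Open Scope ring_scope.
Local Open Scope complex_scope.
Local Open Scope sesquilinear_scope.

(** Polarization: the values at [e_i + c e_j], for [c = 1] and [c] a square root
    of [-1], determine the coefficients [T i j] and [T j i]. *)
Lemma sesqui_diag_eq0 (C : numClosedFieldType) (k : nat) (T : 'M[C]_k) :
  (forall f : 'rV[C]_k, (f *m T *m f^t*) 0 0 = 0) -> T = 0.
Proof.
move=> T0; pose e i : 'rV[C]_k := delta_mx 0 i.
have eE i j : (e i *m T *m (e j)^t*) 0 0 = T i j.
  by rewrite trmx_delta map_delta_mx -rowE -colE !mxE.
have Tdiag i : T i i = 0 by rewrite -eE.
have expand c i j : c^* * T i j + c * T j i = 0.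
  have entryD (A B : 'M[C]_1) : (A + B) 0 0 = A 0 0 + B 0 0 by rewrite mxE.
  have entryZ b (A : 'M[C]_1) : (b *: A) 0 0 = b * A 0 0 by rewrite mxE.
  have := T0 (e i + c *: e j).
  have -> : (e i + c *: e j)^t* = (e i)^t* + c^* *: (e j)^t*.
    by apply/matrixP=> u v; rewrite !mxE rmorphD rmorphM.
  rewrite !mulmxDl !mulmxDr -!scalemxAl -!scalemxAr.
  by rewrite !(entryD, entryZ) !eE !Tdiag !mulr0 addr0 add0r.
apply/matrixP=> i j; rewrite mxE.
(* [c = 1] kills the symmetric part of [T], [c = 'i] the antisymmetric one. *)
have := expand 1 i j; rewrite conjC1 !mul1r => /eqP; rewrite addr_eq0 => /eqP Tij.
have /eqP := expand 'i%R i j; rewrite conjCi Tij mulrNN -mulrDr mulf_eq0.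
by rewrite (negPf (neq0Ci _)) /= -mulr2n mulrn_eq0 /= => /eqP ->; rewrite oppr0.
Qed.

Definition frame_mx (C : numClosedFieldType) (n k : nat) (F : 'I_n -> 'rV[C]_k) :
    'M[C]_(n, k) :=
  \matrix_i F i.

Lemma gramian_frame_mx (R : realType) (n k : nat) (F : 'I_n -> 'rV[R[i]]_k) :
  gramian F = (frame_mx F *m (frame_mx F)^t*)^T.
Proof.
apply/matrixP=> i j; rewrite !mxE dotmxE mxE.
by apply: eq_bigr => l _; rewrite !mxE.
Qed.

Lemma sum_sqr_dotmx (C : numClosedFieldType) (n k : nat) (F : 'I_n -> 'rV[C]_k)
    (f : 'rV[C]_k) :
  \sum_(i < n) `|dotmx f (F i)| ^+ 2 =
  (f *m ((frame_mx F)^t* *m frame_mx F) *m f^t*) 0 0.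
Proof.
have -> : f *m ((frame_mx F)^t* *m frame_mx F) *m f^t* =
          f *m (frame_mx F)^t* *m (f *m (frame_mx F)^t*)^t*.
  by rewrite trmx_mul map_mxM trmxCK !mulmxA.
rewrite mxE; apply: eq_bigr => i _; rewrite !mxE normCK.
by congr (_ * _^*); rewrite dotmxE mxE; apply: eq_bigr => l _; rewrite !mxE.
Qed.

Lemma tight_bound_frame_operator (R : realType) (n k : nat) (a : R)
    (F : 'I_n -> 'rV[R[i]]_k) :
  frame_bounds a a F <-> (frame_mx F)^t* *m frame_mx F = (a%:C)%:M.
Proof.
have scalarE (f : 'rV[R[i]]_k) : (f *m (a%:C)%:M *m f^t*) 0 0 = a%:C * dotmx f f.
  by rewrite mul_mx_scalar -scalemxAl mxE dotmxE.
split=> [tightF | SE f]; last by rewrite sum_sqr_dotmx SE scalarE lexx.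
apply/eqP; rewrite -subr_eq0; apply/eqP/sesqui_diag_eq0 => f.
have entryB (A B : 'M[R[i]]_1) : (A - B) 0 0 = A 0 0 - B 0 0 by rewrite !mxE.
rewrite mulmxBr mulmxBl entryB scalarE -sum_sqr_dotmx.
by apply/eqP; rewrite subr_eq0 eq_le andbC; apply: tightF.
Qed.

(** A vector orthogonal to all the [F i] violates the lower frame bound. *)
Lemma frame_row_free (R : realType) (n k : nat) (F : 'I_n -> 'rV[R[i]]_k) :
  is_frame F -> row_free ((frame_mx F)^t*).
Proof.
case=> A [B [A_gt0 _ boundF]]; apply: inj_row_free => f fM0.
have /andP[+ _] := boundF f; rewrite sum_sqr_dotmx mulmxA fM0 !mul0mx mxE.
apply: contraTeq => f_neq0; rewrite lt_geF // mulr_gt0 ?ltcR //.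
exact: neq0_dnorm_gt0.
Qed.

(** Multiplying [M^* M = a I] by [M] and [M^*] gives [(M M^* )^2 = a M M^*];
    conversely [M^*] is injective, so it can be cancelled on both sides. *)
Lemma tight_bound_gramian (R : realType) (n k : nat) (a : R)
    (F : 'I_n -> 'rV[R[i]]_k) :
  is_frame F ->
  frame_bounds a a F <-> gramian F *m gramian F = a%:C *: gramian F.
Proof.
move=> /frame_row_free; rewrite gramian_frame_mx.
rewrite -trmx_mul -linearZ /=; move: (tight_bound_frame_operator a F).
set M := frame_mx F => tightE freeM; apply: (iff_trans tightE).
have MSM : M *m M^t* *m (M *m M^t*) = M *m (M^t* *m M) *m M^t*.
  by rewrite !mulmxA.
split=> [SE | /trmx_inj].
  by rewrite MSM SE mul_mx_scalar -scalemxAl.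
rewrite MSM scalemxAl -mul_mx_scalar => /(row_free_inj freeM).
(* The adjoint of [M S = M (a I)] is [S M^* = a M^*]. *)
move=> /(congr1 (fun X : 'M_(n, k) => X^t*)).
rewrite !trmx_mul !map_mxM trmxCK tr_scalar_mx map_scalar_mx.
move=> /(row_free_inj freeM) ->; congr (_%:M).
by apply/CrealP/complex_realP; exists a.
Qed.

Lemma laplacianE (K : pzRingType) (n : nat) (G : simple_graph n) (i j : 'I_n) :
  laplacian K G i j = (degree G i)%:R *+ (i == j) - (adj G i j)%:R.
Proof. by rewrite !mxE. Qed.

Lemma laplacian_mul_ones (K : pzRingType) (n m : nat) (G : simple_graph n) :
  laplacian K G *m const_mx 1 = 0 :> 'M[K]_(n, m).
Proof.
apply/matrixP=> i j; rewrite !mxE.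
under eq_bigr => l _ do rewrite laplacianE mxE mulr1.
rewrite sumrB (bigD1 i) //= eqxx big1 => [|l]; last by rewrite eq_sym => /negPf->.
by rewrite addr0 -natr_sum /degree -sum1dep_card big_mkcond subrr.
Qed.

Lemma laplacian_complete (K : pzRingType) (n : nat) (G : simple_graph n) :
  complete_graph G -> laplacian K G = n%:R%:M - const_mx 1.
Proof.
move=> complG; have adjE i j : adj G i j = (i != j).
  by case: eqVneq => [->|/complG //]; rewrite adj_irrefl.
apply/matrixP=> i j; rewrite laplacianE !mxE adjE.
case: eqVneq => [_|_]; last by rewrite !mulr0n.
have -> : degree G i = n.-1.
  rewrite -[n in RHS]card_ord -(cardC1 i) /degree cardsE.
  by apply: eq_card => l; rewrite !inE -topredE /= adjE eq_sym.
by rewrite -subn1 natrB ?(leq_ltn_trans _ (ltn_ord i)) // subr0.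
Qed.

Lemma laplacian_complete_sq (K : comPzRingType) (n : nat) (G : simple_graph n) :
  complete_graph G ->
  laplacian K G *m laplacian K G = n%:R *: laplacian K G.
Proof.
move=> complG; rewrite {2}(laplacian_complete K complG) mulmxBr.
by rewrite laplacian_mul_ones subr0 mul_mx_scalar.
Qed.

(** If [i] and [j] are distinct and nonadjacent, the diagonal entries do not
    contribute to [(L^2)_ij], which is then a sum of the nonnegative terms
    [adj i l * adj l j]; since it equals [a L_ij = 0], every term vanishes. *)
Lemma laplacian_sq_adj_trans (K : numDomainType) (n : nat) (G : simple_graph n)
    (a : K) :
  laplacian K G *m laplacian K G = a *: laplacian K G ->
  forall i j l : 'I_n, i != j -> adj G i l -> adj G l j -> adj G i j.
Proof.
move=> /matrixP LL i j l i_neq_j il lj; apply: contraT => /negPf nij.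
have Lij : laplacian K G i j = 0.
  by rewrite laplacianE nij (negPf i_neq_j) subr0.
have term m : laplacian K G i m * laplacian K G m j =
              (adj G i m)%:R * (adj G m j)%:R.
  rewrite !laplacianE; case: (eqVneq i m) => [<-|_].
    by rewrite (negPf i_neq_j) adj_irrefl nij subrr mulr0 mul0r.
  case: (eqVneq m j) => [->|_]; last by rewrite !sub0r mulrNN.
  by rewrite nij adj_irrefl subrr mul0r mulr0.
have := LL i j; rewrite mxE [RHS]mxE Lij mulr0.
under eq_bigr => m _ do rewrite term.
move/psumr_eq0P => /(_ _ l isT); rewrite il lj mulr1 => sum0.
suff /eqP : 1 = 0 :> K by rewrite oner_eq0.
by apply: sum0 => m _; rewrite mulr_ge0 ?ler0n.
Qed.

(** The hypothesis makes the closed neighbourhood of [i] stable under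
    adjacency, so by connectedness it contains every vertex. *)
Lemma connected_adj_trans_complete (n : nat) (G : simple_graph n) :
  connected_graph G ->
  (forall i j l : 'I_n, i != j -> adj G i l -> adj G l j -> adj G i j) ->
  complete_graph G.
Proof.
move=> connG transG i j i_neq_j.
pose N := [pred l | (l == i) || adj G i l].
have closedN : closed G N.
  apply: intro_closed => [|x y xy]; first exact/sym_connect_sym/adj_sym.
  rewrite !inE; case: (eqVneq y i) => //= y_neq_i.
  by case/orP => [/eqP <- //|ix]; apply: transG ix xy; rewrite eq_sym.
have := closed_connect closedN (connG i j).
by rewrite !inE eqxx eq_sym (negPf i_neq_j).
Qed.

Theorem corollary4p7 (R : realType) (n k : nat) (G : simple_graph n)
    (F : 'I_n -> 'rV[R[i]]_k) :
  connected_graph G -> frame_generated_by G F ->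
  (is_tight_frame F <-> complete_graph G).
Proof.
move=> connG [frameF gramF]; split.
  case=> a [_ /(tight_bound_gramian _ frameF)]; rewrite gramF => LL.
  exact: connected_adj_trans_complete connG (laplacian_sq_adj_trans LL).
move=> complG.
(* Without vertices every bound is tight, but the bound must be positive. *)
exists (maxn n 1)%:R; split; first by rewrite ltr0n leq_max orbT.
apply/(tight_bound_gramian _ frameF); rewrite gramF.
rewrite (laplacian_complete_sq _ complG) rmorph_nat.
case: n {F frameF gramF connG complG} G => [|n] G; last by rewrite (maxn_idPl _).
by apply/matrixP => - [].
Qed.
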